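(* Let $\epsilon>0$ and let $I_0=(-2\epsilon,-\epsilon]\cup[\epsilon,2\epsilon)$. For every function $y_0:I_0\to\mathbb{R}$ there is a unique function $y:\mathbb{R}\setminus\{0\}\to\mathbb{R}$ such that $y(x)=y(-2x)$ for all $x\in\mathbb{R}\setminus\{0\}$ and $y(x)=y_0(x)$ for all $x\in I_0$.
   Context: No continuity is assumed. *)

(* Defs.v *)
From mathcomp Require Import all_boot all_order all_algebra.
From mathcomp Require Import lra.
From mathcomp Require Import boolp classical_sets functions set_interval reals.

Set Implicit Arguments.
Unset Strict Implicit.
Unset Printing Implicit Defensive.

Import Order.TTheory GRing.Theory Num.Theory.
Local Open Scope classical_set_scope.
Local Open Scope ring_scope.

Definition I0 {R : realType} (eps : R) : set R :=
  `]-2 * eps, - eps] `|` `[eps, 2 * eps[.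

Definition nonzero (R : realType) : set R := [set~ 0].
Arguments nonzero : clear implicits.

Lemma I0_nonzero (R : realType) (eps : R) :
  0 < eps -> I0 eps `<=` nonzero R.
Proof.
move=> eps_gt0 x + x0; rewrite /I0 x0 /= !in_itv /=.
by case=> /andP[]; lra.
Qed.

Lemma mulN2_nonzero (R : realType) (x : R) :
  nonzero R x -> nonzero R (-2 * x).
Proof.
by move=> x0 /eqP; rewrite mulf_eq0 oppr_eq0 pnatr_eq0 /= => /eqP.
Qed.

Definition mulN2 {R : realType} (x : nonzero R) : nonzero R :=
  SigSub (mem_set (mulN2_nonzero (set_valP x))).

(* Main.v *)
(* A point [a] lies in [I0 eps] exactly when [eps <= `|a| < 2 * eps].  As
   multiplication by -2 doubles absolute values, every orbit of it on the
   nonzero reals meets [I0 eps] in exactly one point, and a function with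
   [y x = y (-2 * x)] is one that is constant on orbits. *)
Require Import Defs.
From mathcomp Require Import all_boot all_order all_algebra.
From mathcomp Require Import lra.
From mathcomp Require Import boolp classical_sets functions set_interval reals.

Set Implicit Arguments.
Unset Strict Implicit.
Unset Printing Implicit Defensive.

Import Order.TTheory GRing.Theory Num.Theory.
Local Open Scope classical_set_scope.
Local Open Scope ring_scope.

Lemma I0P (R : realType) (eps a : R) :
  0 < eps -> I0 eps a <-> eps <= `|a| < 2 * eps.
Proof.
move=> eps_gt0; rewrite /I0 /= !in_itv /=; split.
  by case=> /andP[? ?]; apply/andP; [rewrite ler0_norm|rewrite ger0_norm]; lra.
by case: (ger0P a) => a0 /andP[? ?]; [right|left]; apply/andP; lra.
Qed.

Lemma neqN2_0 (R : numDomainType) : (-2 : R) != 0.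
Proof. by rewrite oppr_eq0 pnatr_eq0. Qed.

Lemma normrN2X (R : realType) (k : int) : `|(-2 : R) ^ k| = 2 ^ k.
Proof.
by case: k => n; rewrite ?NegzE -?exprnN -?exprnP ?normfV normrX normrN normr_nat.
Qed.

(** Scaling by a large [2 ^+ N] brings [t] to at least 1. If [m] is the least natural number with
    [t * 2 ^+ N < 2 ^+ m.+1], then [k = N - m] works. *)
Lemma exists_exp2_floor (R : archiRealFieldType) (t : R) :
  0 < t -> exists k : int, 1 <= t * 2 ^ k < 2.
Proof.
move=> t_gt0.
have bound (u : R) : exists n, u < 2 ^+ n.
  exists (Num.trunc u).+1; apply: lt_trans (truncnS_gt u) _.
  by rewrite -natrX ltr_nat ltn_expl.
have [N tN] := bound t^-1.
have s_ge1 : 1 <= t * 2 ^+ N by rewrite -ler_pdivrMl ?mulr1 // ltW.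
have P : exists n, t * 2 ^+ N < 2 ^+ n.+1.
  have [n sn] := bound (t * 2 ^+ N).
  by exists n; apply: lt_trans sn _; rewrite ltr_eXn2l ?ltr1n.
case: (ex_minnP P) => m sm m_min.
(* For [m = 0] this is [s_ge1]; for a successor, its failure would contradict the minimality of
   [m]. *)
have ms : 2 ^+ m <= t * 2 ^+ N.
  case: m sm m_min => [|m] _ m_min; first by rewrite expr0.
  by rewrite leNgt; apply/negP => /m_min; rewrite ltnn.
exists (N%:Z - m%:Z); rewrite expfzDr ?pnatr_eq0 // -exprnN -exprnP mulrA.
have m_gt0 : 0 < 2 ^+ m :> R by rewrite exprn_gt0.
by rewrite ler_pdivlMr // mul1r ms ltr_pdivrMr // -exprS.
Qed.

Lemma I0_orbit_exists (R : realType) (eps x : R) :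
  0 < eps -> x != 0 -> exists k : int, I0 eps (x * (-2) ^ k).
Proof.
move=> eps_gt0 x0.
have [|k /andP[k1 k2]] := @exists_exp2_floor R (`|x| / eps).
  by rewrite divr_gt0 ?normr_gt0.
exists k; apply/(I0P _ eps_gt0); rewrite normrM normrN2X.
move: k1 k2; rewrite mulrAC ler_pdivlMr // ltr_pdivrMr // mul1r.
by move=> -> ->.
Qed.

(** Two absolute values in [[eps, 2 * eps)] have a ratio strictly between 1/2 and 2. Here the ratio
    is [2 ^ k], so [-1 < k < 1]. *)
Lemma I0_orbit_unique (R : realType) (eps a : R) (k : int) :
  0 < eps -> I0 eps a -> I0 eps (a * (-2) ^ k) -> k = 0.
Proof.
move=> eps_gt0 /(I0P _ eps_gt0)/andP[a1 a2] /(I0P _ eps_gt0).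
rewrite normrM normrN2X => /andP[b1 b2].
have a_gt0 : 0 < `|a| by apply: lt_le_trans a1.
have two_gt1 : 1 < 2 :> R by rewrite ltr1n.
have kN : k < 1.
  rewrite -(ltr_eXz2l two_gt1) expr1z -(ltr_pM2l a_gt0).
  by apply: lt_le_trans b2 _; rewrite mulrC ler_pM2r.
have k1 : -1 < k.
  rewrite -(ltr_eXz2l two_gt1) exprN1 -(ltr_pM2l a_gt0).
  by apply: lt_le_trans b1; rewrite ltr_pdivrMr // mulrC.
by apply/eqP; rewrite eq_le -ltzD1 add0r kN /= -(addNr 1) lezD1.
Qed.

Lemma mulN2_invariant_orbit (R : realType) (T : Type) (y : nonzero R -> T) :
  (forall x, y x = y (mulN2 x)) ->
  forall (k : int) (x z : nonzero R), \val z = \val x * (-2) ^ k -> y z = y x.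
Proof.
move=> yN2.
have nat_orbit (n : nat) (x z : nonzero R) :
    \val z = \val x * (-2) ^+ n -> y z = y x.
  elim: n x => [|n IHn] x zx.
    by congr y; apply: val_inj; rewrite zx mulr1.
  by rewrite (yN2 x); apply: IHn; rewrite zx exprS mulrA (mulrC (\val x)).
case=> n x z; first exact: nat_orbit.
(* A negative exponent reverses the roles: [x] is then reached from [z] by a positive power. *)
rewrite NegzE -exprnN => zx; apply/esym/(nat_orbit n.+1).
by rewrite zx mulfVK // expf_neq0 // neqN2_0.
Qed.

Theorem theorem3p9 (R : realType) (eps : R) (eps_gt0 : 0 < eps)
    (y0 : I0 eps -> R) :
  exists! y : nonzero R -> R,
    (forall x : nonzero R, y x = y (mulN2 x)) /\
    (forall x : I0 eps, y (subfun (I0_nonzero eps_gt0) x) = y0 x).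
Proof.
have neq0 (x : nonzero R) : \val x != 0 by apply/eqP; exact: set_valP x.
have orbit (x : nonzero R) :
    exists z : I0 eps, exists k : int, \val z = \val x * (-2) ^ k.
  have [k xk] := I0_orbit_exists eps_gt0 (neq0 x).
  by exists (SigSub (mem_set xk)), k.
have [rep repP] := choice orbit.
(* The chosen representative depends only on the orbit: [rep x] and [z] differ by the factor
   [(-2) ^ (l - k)], and both lie in [I0 eps], which forces [l = k]. *)
have repE (x : nonzero R) (z : I0 eps) (k : int) :
    \val z = \val x * (-2) ^ k -> rep x = z.
  move=> zx; have [l rx] := repP x; apply: val_inj.
  have rz : \val (rep x) = \val z * (-2) ^ (l - k).
    by rewrite zx -mulrA -expfzDr ?neqN2_0 // addrC subrK.
  rewrite rz (I0_orbit_unique (k := l - k) eps_gt0 (set_valP z)) ?mulr1 //.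
  by rewrite -rz; exact: set_valP.
exists (y0 \o rep); split; first split.
- move=> x /=; congr y0; have [k rx] := repP (mulN2 x).
  apply: (repE _ _ (1 + k)).
  by rewrite rx expfzDr ?neqN2_0 // expr1z mulrA (mulrC (\val x)).
- by move=> x /=; congr y0; apply: (repE _ _ 0); rewrite mulr1.
(* Uniqueness: [y] is constant on the orbit of [x], so its value there is the one prescribed at
   [rep x]. *)
- move=> y [yN2 yI0]; apply: funext => x /=; have [k rx] := repP x.
  by rewrite -yI0; exact: (mulN2_invariant_orbit yN2 (k := k)).
Qed.
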